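(* Let $\Omega^L$ be the deficient digit set, $\mathcal{B}$ the small breakpoint set, and $I_B$ ($B\in\mathcal{B}$) the associated open intervals, as defined in the context. (1) $\Omega^L$ is exactly the set of leftmost endpoints of all local level sets. It satisfies $\Omega^L\subset[0,\frac13]$. (2) $\Omega^L$ is a closed, perfect set (Cantor set). It is given by $$\Omega^L=[0,1)\setminus\bigcup_{B\in\mathcal{B}}I_B,$$ where the omitted open intervals $I_B$ have right endpoint a dyadic rational and left endpoint a rational number with denominator $3\cdot2^k$ for some $k\ge0$. (3) $\Omega^L$ has Lebesgue measure zero.
   Context: For a binary expansion $x=0.b_1b_2\ldots=\sum_{j\ge1}b_j2^{-j}$, $b_j\in\{0,1\}$, put $D_0(x)=0$ and $D_j(x)=j-2(b_1+\cdots+b_j)$ for $j\ge1$. The deficient digit set $\Omega^L$ is the set of all $x\in[0,1]$ having a binary expansion with $D_j(x)\ge0$ for all $j\ge1$ (at most one of the two expansions of a dyadic rational can have this property; if one does, the dyadic rational belongs to $\Omega^L$). Local level sets: elements are binary expansions (dyadic rationals in $(0,1)$ have two, treated as distinct). The balance-set is $Z(x)=\{j\ge 0: D_j(x)=0\}=\{c_0<c_1<\cdots\}$ with $c_0=0$; if $Z(x)$ is finite with last element $c_n$, set $c_{n+1}=+\infty$. The $k$-th block $B_k(x)$ is the indexed string of digits $(b_j)_{c_k<j\le c_{k+1}}$ (all $j>c_k$ if $c_{k+1}=+\infty$). Write $x\sim x'$ if $Z(x)=Z(x')$ and for each $k$ the block $B_k(x')$ either equals $B_k(x)$ or is obtained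 from it by flipping every digit. The local level set of $x$ is $L_x^{loc}=\{x':x'\sim x\}$. The small breakpoint set $\mathcal{B}$ consists of $B_\emptyset=0$ together with all dyadic rationals $B=0.b_1b_2\cdots b_{2m}$, $m\ge1$, with $D_j(B)\ge0$ for $1\le j\le 2m-1$, $D_{2m}(B)=0$, and $b_{2m-1}=b_{2m}=1$. Each $B\in\mathcal{B}$, $B\ne B_\emptyset$, is written uniquely as $B=0.b_1\cdots b_\ell\,0\,1^k$ with $k\ge2$, $2m=k+\ell+1$, and one sets $I_B=(x(B)^-,x(B)^+)$ with $$x(B)^-=0.b_1\cdots b_\ell\,0\,1^k(01)^\infty,\qquad x(B)^+=0.b_1\cdots b_\ell\,1\,0^k0^\infty .$$ For $B=B_\emptyset$ set $I_{B_\emptyset}=(\frac13,1)$. Here $w^\infty$ denotes infinite repetition of the string $w$. *)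

(* Defs.v *)
From mathcomp Require Import all_boot all_order all_algebra.
From mathcomp Require Import all_classical all_reals all_analysis.

Set Implicit Arguments.
Unset Strict Implicit.
Unset Printing Implicit Defensive.

Import Order.TTheory GRing.Theory Num.Theory.
Import numFieldNormedType.Exports.

Local Open Scope classical_set_scope.
Local Open Scope ring_scope.

(* The expansion 0.b_1 b_2 ... is stored 0-based: b i is the digit b_{i+1}.
   The two expansions of a dyadic rational in (0,1) are different elements. *)
Definition expansion := nat -> bool.

Definition value (R : realType) (b : expansion) : R :=
  limn (series (fun i : nat => (b i)%:R / 2 ^+ i.+1 : R)).

Definition digit_sum (b : expansion) (j : nat) : nat := (\sum_(i < j) b i)%N.

Definition deficient (b : expansion) (j : nat) : int :=
  j%:Z - 2 * (digit_sum b j)%:Z.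

Definition deficient_digit_set (R : realType) : set R :=
  [set x | 0 <= x <= 1 /\ exists b : expansion,
     value R b = x /\ forall j, (1 <= j)%N -> 0 <= deficient b j].

Arguments deficient_digit_set R : clear implicits.

Definition balance_set (b : expansion) : set nat :=
  [set j | deficient b j = 0].

(* 0-based positions i of the digits in the block that starts at c = c_k, that
   is c_k < i+1 <= c_{k+1}: no balance point lies in (c, i]. If c is the last
   balance point, these are all positions i >= c. *)
Definition block (b : expansion) (c : nat) : set nat :=
  [set i | (c <= i)%N /\
     forall j, (c < j)%N -> (j <= i)%N -> ~ balance_set b j].

Definition locally_equivalent (b b' : expansion) : Prop :=
  balance_set b = balance_set b' /\
  forall c, balance_set b c ->
    (forall i, block b c i -> b' i = b i) \/
    (forall i, block b c i -> b' i = ~~ b i).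

Definition local_level_set (b : expansion) : set expansion :=
  [set b' | locally_equivalent b' b].

Definition leftmost_endpoint (R : realType) (L : set expansion) (x : R) : Prop :=
  (value R @` L) x /\ lbound (value R @` L) x.

Definition word_then (w : seq bool) (t : expansion) : expansion :=
  fun i => if (i < size w)%N then nth false w i else t (i - size w)%N.

Definition zeros : expansion := fun=> false.

(* (01)^oo *)
Definition zero_ones : expansion := odd.

Definition small_breakpoint_word (w : seq bool) : Prop :=
  exists m : nat,
  [/\ (1 <= m)%N,
      size w = (2 * m)%N,
      forall j, (1 <= j)%N -> (j <= 2 * m - 1)%N ->
        0 <= deficient (word_then w zeros) j,
      deficient (word_then w zeros) (2 * m) = 0 &
      nth false w (2 * m - 2) = true /\ nth false w (2 * m - 1) = true].

Definition small_breakpoints (R : realType) : set R :=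
  [set B | B = 0 \/
     exists w, small_breakpoint_word w /\ B = value R (word_then w zeros)].

Arguments small_breakpoints R : clear implicits.

(* lo = x(B)^- and hi = x(B)^+. A nonzero B has exactly one decomposition
   B = 0.b_1...b_l 0 1^k with k >= 2, here l = b_1...b_l; B = 0 has none. *)
Definition omitted_endpoints (R : realType) (B lo hi : R) : Prop :=
  [/\ B = 0, lo = 1 / 3 & hi = 1] \/
  exists (l : seq bool) (k : nat),
    let w := l ++ false :: nseq k true in
    [/\ (2 <= k)%N,
        small_breakpoint_word w,
        B = value R (word_then w zeros),
        lo = value R (word_then w zero_ones) &
        hi = value R (word_then (l ++ true :: nseq k false) zeros)].

Definition omitted_interval (R : realType) (B : R) : set R :=
  [set x | exists lo hi, omitted_endpoints B lo hi /\ lo < x < hi].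

Definition dyadic_rational (R : realType) (x : R) : Prop :=
  exists (p : int) (k : nat), x = p%:~R / 2 ^+ k.

Definition has_denominator (R : realType) (d : nat) (x : R) : Prop :=
  exists q : rat, x = ratr q /\ denq q = d%:Z.

Definition cantor_set (R : realType) (A : set R) : Prop :=
  [/\ A !=set0, compact A, perfect_set A & totally_disconnected A].

(* Main.v *)
Require Import Defs.
From mathcomp Require Import all_boot all_order all_algebra.
From mathcomp Require Import all_classical all_reals all_analysis.
From mathcomp Require Import measurable_realfun.
From mathcomp Require Import lra ring zify.

Set Implicit Arguments.
Unset Strict Implicit.
Unset Printing Implicit Defensive.

Import Order.TTheory GRing.Theory Num.Theory.
Import numFieldNormedType.Exports.

Local Open Scope classical_set_scope.
Local Open Scope ring_scope.

(** Regard the deficiencies [deficient b 0], [deficient b 1], ... as a walk with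
    steps [1] (digit [0]) and [-1] (digit [1]). The deficient digit set consists
    of the values of the walks that stay nonnegative ([never_negative]).

    Summation by parts ([partial_sum_Abel]) shows that the value of an expansion
    is monotone in its digit sums, so that a higher walk has a smaller value
    ([le_value]). Two consequences: a nonnegative walk has value at most [1/3],
    because [(01)^oo] is the lowest such walk; and in a local level set the
    leftmost point is the highest walk. Flipping blocks changes the walk only by
    signs ([equivalent_deficient]), and the absolute value of the walk is
    attained in the class ([reflection]), so the leftmost points are exactly the
    values of nonnegative walks.

    Omitted intervals. If [w] returns to height [0] without going below it, and
    a nonnegative walk starts with [w], then its tail is again nonnegative and
    its value is at most that of [w (01)^oo]; hence no point lies strictly
    between [w (01)^oo] and [w 1^oo] ([omitted_interval_disjoint]). Conversely,
    a walk that reaches [-1] has a balance point with tail larger than [1/3],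
    and at the least one the preceding word is empty or ends with [11]
    ([omitted_interval_cover]). Since all points are at most [1/3], the
    complement of these open intervals is closed. In a nonnegative walk
    some arbitrarily far digits can be flipped without making it negative, so no
    point is isolated ([never_negative_flip]).

    Measure. The set is covered by the dyadic intervals of length [2^-n] whose
    word keeps the walk nonnegative, so its measure is at most the probability
    that a fair walk survives [n] steps. The limit of this probability, as a
    function of the starting height, is harmonic and vanishes at the barrier,
    so it is linear; it is bounded by [1], so it is [0] ([survival_cvg0]). A
    null set contains no interval, which gives total disconnectedness. *)

(** * Digits, digit sums and deficiencies *)

Definition drop_digits (n : nat) (b : expansion) : expansion :=
  fun i => b (n + i)%N.

Definition ones : expansion := fun=> true.

Lemma drop_digitsD m n b :
  drop_digits m (drop_digits n b) = drop_digits (n + m)%N b.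
Proof. by apply/funext => i; rewrite /drop_digits addnA. Qed.

Lemma drop1_word_then_cons a w t :
  drop_digits 1 (word_then (a :: w) t) = word_then w t.
Proof. by apply/funext => i; rewrite /drop_digits /word_then /= add1n. Qed.

Lemma word_then_nil t : word_then [::] t = t.
Proof. by apply/funext => i; rewrite /word_then /= subn0. Qed.

Lemma word_then_take n b : word_then (mkseq b n) (drop_digits n b) = b.
Proof.
apply/funext => i; rewrite /word_then /drop_digits size_mkseq.
by case: ltnP => hi; rewrite ?nth_mkseq // subnKC.
Qed.

Lemma word_then_cat u v t : word_then (u ++ v) t = word_then u (word_then v t).
Proof.
apply/funext => i; rewrite /word_then size_cat nth_cat.
case: (ltnP i (size u)) => hu; first by rewrite ltn_addr.
by rewrite subnDA ltn_subLR.
Qed.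

Lemma digit_sum0 b : digit_sum b 0 = 0%N.
Proof. by rewrite /digit_sum big_ord0. Qed.

Lemma digit_sumS b j : digit_sum b j.+1 = (digit_sum b j + b j)%N.
Proof. by rewrite /digit_sum big_ord_recr. Qed.

Lemma deficient0 b : deficient b 0 = 0.
Proof. by rewrite /deficient digit_sum0. Qed.

Lemma deficientS b j :
  deficient b j.+1 = deficient b j + (if b j then -1 else 1).
Proof. by rewrite /deficient digit_sumS; case: (b j) => /=; lia. Qed.

Lemma deficientD b n j :
  deficient b (n + j)%N = deficient b n + deficient (drop_digits n b) j.
Proof.
elim: j => [|j IH]; first by rewrite addn0 deficient0 addr0.
by rewrite addnS !deficientS IH -addrA.
Qed.

Lemma eq_deficient b c j : (forall i, (i < j)%N -> b i = c i) ->
  deficient b j = deficient c j.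
Proof.
move=> bc; rewrite /deficient /digit_sum; congr (_ - 2 * Posz _).
by apply: eq_bigr => i _; rewrite bc.
Qed.

Lemma deficient_even b j : deficient b j = 0 -> ~~ odd j.
Proof. by rewrite /deficient => h; lia. Qed.

Definition never_negative (b : expansion) : Prop :=
  forall j, 0 <= deficient b j.

Lemma never_negativeP b :
  never_negative b <-> (forall j, (1 <= j)%N -> 0 <= deficient b j).
Proof.
split=> [nb j _|nb [|j]]; first exact: nb.
  by rewrite deficient0.
exact: nb.
Qed.

(** * The value of an expansion *)

Section Value.
Variable R : realType.

Implicit Types b c t : expansion.

Notation value := (value R).
Let term b : R^nat := fun i => (b i)%:R / 2 ^+ i.+1.

Lemma is_cvg_value b : cvgn (series (term b)).
Proof.
apply: (@series_le_cvg _ _ (geometric (1/2) (1/2))).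
- by move=> n; rewrite /term divr_ge0 // exprn_ge0.
- by move=> n; rewrite mulr_ge0 // ?exprn_ge0 //; lra.
- move=> n; rewrite /term /geometric /= exprS invfM expr_div_n expr1n !mul1r.
  by rewrite -[leRHS]mul1r ler_wpM2r // ?invr_ge0 ?mulr_ge0 ?exprn_ge0 //; case: (b n).
- by apply: is_cvg_geometric_series; rewrite ger0_norm; lra.
Qed.

(** Abel summation: [b i] is the difference of two consecutive digit sums, and
    in the rearranged partial sum every digit sum has a positive weight. This
    turns inequalities between deficiencies into inequalities between values. *)
Lemma partial_sum_Abel b n :
  series (term b) n =
  (digit_sum b n)%:R / 2 ^+ n + \sum_(i < n) (digit_sum b i)%:R / 2 ^+ i.+1.
Proof.
rewrite /series /= big_mkord; elim: n => [|n IH].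
  by rewrite !big_ord0 digit_sum0 mul0r addr0.
rewrite !big_ord_recr /= IH /term digit_sumS natrD exprS.
by field; rewrite expf_neq0.
Qed.

Lemma le_value b c :
  (forall j, (digit_sum b j <= digit_sum c j)%N) -> value b <= value c.
Proof.
move=> bc; apply: ler_lim; [exact: is_cvg_value|exact: is_cvg_value|].
apply: nearW => n; rewrite -/(term b) -/(term c) !partial_sum_Abel.
apply: lerD; first by rewrite ler_wpM2r ?invr_ge0 ?exprn_ge0 // ler_nat.
by apply: ler_sum => i _; rewrite ler_wpM2r ?invr_ge0 ?exprn_ge0 // ler_nat.
Qed.

Lemma value_rec b : value b = (b 0%N)%:R / 2 + value (drop_digits 1 b) / 2.
Proof.
rewrite /value -/(term b) -/(term (drop_digits 1 b)).
apply: cvg_lim => //; rewrite -(cvg_shiftS (series (term b))).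
have -> : (fun n => series (term b) n.+1) =
   (fun n => (b 0%N)%:R / 2 + series (term (drop_digits 1 b)) n / 2).
  apply/funext => n; rewrite /series /= !big_mkord big_ord_recl mulr_suml.
  congr (_ + _); apply: eq_bigr => i _.
  by rewrite /term /drop_digits /bump /= exprSr invfM mulrA.
by apply: cvgD; [exact: cvg_cst|apply: cvgMl; exact: is_cvg_value].
Qed.

Lemma value_zeros : value zeros = 0.
Proof. by have := value_rec zeros; rewrite /= /drop_digits; lra. Qed.

Lemma value_ones : value ones = 1.
Proof. by have := value_rec ones; rewrite /= /drop_digits; lra. Qed.

Lemma value_zero_ones : value zero_ones = 1 / 3.
Proof.
have := value_rec zero_ones.
rewrite [value (drop_digits 1 _)]value_rec drop_digitsD.
have -> : drop_digits (1 + 1)%N zero_ones = zero_ones.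
  by apply/funext => i; rewrite /drop_digits /zero_ones oddD.
by rewrite /= /drop_digits /zero_ones /=; lra.
Qed.

Lemma value_ge0 b : 0 <= value b.
Proof.
rewrite -value_zeros; apply: le_value => j.
by rewrite /digit_sum big1.
Qed.

Lemma value_le1 b : value b <= 1.
Proof.
rewrite -value_ones; apply: le_value => j.
by apply: leq_sum => i _; case: (b i).
Qed.

Lemma value_eq1 b : value b = 1 -> forall i, b i.
Proof.
move=> + i; elim: i b => [|i IH] b vb.
  have := value_rec b; have := value_le1 (drop_digits 1 b).
  by case: (b 0%N) => //=; lra.
have /IH : value (drop_digits 1 b) = 1.
  have := value_rec b; have := value_le1 (drop_digits 1 b).
  by case: (b 0%N) => //=; lra.
by rewrite /drop_digits add1n.
Qed.

Lemma value_word_then w t :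
  value (word_then w t) = value (word_then w zeros) + value t / 2 ^+ size w.
Proof.
elim: w => [|a w IH]; first by rewrite !word_then_nil value_zeros /= divr1 add0r.
rewrite value_rec [value (word_then (a :: w) zeros)]value_rec.
by rewrite !drop1_word_then_cons IH /= exprS; field; rewrite expf_neq0.
Qed.

Lemma value_word_nat w :
  exists N : nat, value (word_then w zeros) = N%:R / 2 ^+ size w.
Proof.
elim: w => [|a w [N IH]]; first by exists 0%N; rewrite word_then_nil value_zeros mul0r.
exists (a * 2 ^ size w + N)%N.
rewrite value_rec drop1_word_then_cons IH /= natrD natrM natrX exprS.
by field; rewrite expf_neq0.
Qed.

(** * Standard expansions *)

(** Having infinitely many digits [0] selects one expansion of each number of
    [0 <= x < 1]. It excludes no nonnegative walk, because along a tail of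
    digits [1] the deficiencies tend to minus infinity. *)
Definition standard b := forall n, exists2 i, (n <= i)%N & ~~ b i.

Lemma standard_drop n b : standard b -> standard (drop_digits n b).
Proof.
move=> pb m; have [i nmi bi] := pb (n + m)%N.
by exists (i - n)%N; rewrite /drop_digits ?subnKC //; lia.
Qed.

Lemma standard_word_then w t : standard t -> standard (word_then w t).
Proof.
move=> pt m; have [i nmi bi] := pt m; exists (size w + i)%N; first lia.
by rewrite /word_then ltnNge leq_addr addKn.
Qed.

Lemma standard_zeros : standard zeros.
Proof. by move=> n; exists n. Qed.

Lemma standard_value_lt1 b : standard b -> value b < 1.
Proof.
move=> pb; rewrite lt_neqAle value_le1 andbT; apply/eqP => /value_eq1 b1.
by have [i _] := pb 0%N; rewrite b1.
Qed.

Lemma never_negative_standard b : never_negative b -> standard b.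
Proof.
move=> nb n; apply: contrapT => h.
have tail1 i : b (n + i)%N.
  by apply: contrapT => /negP bi; apply: h; exists (n + i)%N; rewrite ?leq_addr.
have D j : deficient (drop_digits n b) j = - j%:Z.
  by elim: j => [|j IH]; rewrite ?deficient0 // deficientS IH /drop_digits tail1; lia.
by have := nb (n + (absz (deficient b n)).+1)%N; rewrite deficientD D; lia.
Qed.

Lemma standard_first_digit b : standard b -> b 0%N = (1 / 2 <= value b).
Proof.
move=> /(standard_drop 1)/standard_value_lt1 lt1.
have := value_rec b; have := value_ge0 (drop_digits 1 b).
by case: (b 0%N) => /= h1 h2; apply/esym; [|apply/negbTE; rewrite -ltNge]; lra.
Qed.

Lemma standard_value_inj b c : standard b -> standard c -> value b = value c -> b = c.
Proof.
move=> pb pc vbc; apply/funext => i; elim: i b c pb pc vbc => [|i IH] b c pb pc vbc;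
  have bc0 : b 0%N = c 0%N by rewrite !standard_first_digit // vbc.
  exact: bc0.
apply: IH (standard_drop 1 pb) (standard_drop 1 pc) _.
by have := value_rec c; rewrite -vbc value_rec bc0; lra.
Qed.

(** The first digit of a standard expansion is read off its value, so the whole
    prefix can be peeled off by induction. A dyadic left endpoint also has an
    expansion that ends in digits [1] and may start with another word. *)
Lemma standard_prefix w b : standard b ->
  value (word_then w zeros) <= value b < value (word_then w zeros) + 1 / 2 ^+ size w ->
  b = word_then w (drop_digits (size w) b).
Proof.
elim: w b => [|a w IH] b pb; first by rewrite !word_then_nil.
rewrite value_rec drop1_word_then_cons.
have := value_rec b => vb; have p0 : 0 < (2 ^+ size w)^-1 :> R by rewrite invr_gt0 exprn_gt0.
have wlt1 : value (word_then w zeros) + (2 ^+ size w)^-1 <= 1.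
  have := value_le1 (word_then w ones).
  by rewrite value_word_then value_ones mul1r.
have w0 := value_ge0 (word_then w zeros).
have lt1 := standard_value_lt1 (standard_drop 1 pb).
have ge0 := value_ge0 (drop_digits 1 b).
rewrite /= exprS invfM => hb.
have b0 : b 0%N = a.
  by move: hb vb; case: (b 0%N); case: (a) => //= hb vb; exfalso; lra.
have /IH eqw : standard (drop_digits 1 b) by exact: standard_drop.
move: eqw; rewrite drop_digitsD add1n => eqw.
have : drop_digits 1 b = word_then w (drop_digits (size w).+1 b).
  by apply: eqw; move: hb vb; rewrite b0; case: (a) => /=; lra.
move=> eqb; apply/funext => -[|i]; first by rewrite b0.
have := congr1 (@^~ i) eqb; rewrite {1}/drop_digits add1n => ->.
by rewrite /word_then /= subSS ltnS.
Qed.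

(** * The greedy expansion *)

Definition doubling (x : R) : R := if 1 / 2 <= x then 2 * x - 1 else 2 * x.

Definition greedy (x : R) : expansion := fun i => 1 / 2 <= iter i doubling x.

Lemma iter_doubling_itv n x : 0 <= x < 1 -> 0 <= iter n doubling x < 1.
Proof.
elim: n => //= n IH /IH; rewrite /doubling.
by case: (leP (1 / 2)) => h; lra.
Qed.

Lemma drop_greedy n x : drop_digits n (greedy x) = greedy (iter n doubling x).
Proof. by apply/funext => i; rewrite /drop_digits /greedy addnC iterD. Qed.

Lemma eq_of_dist_pow2 (x y : R) : (forall n, `|x - y| <= 1 / 2 ^+ n) -> x = y.
Proof.
move=> h; apply/eqP; rewrite -subr_eq0 -normr_le0; apply/ler_addgt0Pr => e e0.
have [n he] := ltr_add_invr e0.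
rewrite add0r in he; apply: (le_trans (h n.+1)); rewrite add0r.
apply: (le_trans _ (ltW he)); rewrite mul1r lef_pV2 ?posrE ?exprn_gt0 //.
by rewrite -natrX ler_nat ltnW // ltn_expl.
Qed.

Lemma value_greedy x : 0 <= x < 1 -> value (greedy x) = x.
Proof.
move=> hx; apply: eq_of_dist_pow2 => n; elim: n x hx => [|n IH] x hx.
  by rewrite expr0 divr1; have := value_ge0 (greedy x);
    have := value_le1 (greedy x); rewrite ler_norml; lra.
rewrite value_rec drop_greedy; have := IH _ (iter_doubling_itv 1 hx).
rewrite !ler_norml exprS invfM /greedy /= -/(greedy _).
by rewrite /doubling; case: (leP (1 / 2)) => /=; lra.
Qed.

Lemma standard_greedy x : 0 <= x < 1 -> standard (greedy x).
Proof.
move=> hx n; apply: contrapT => h.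
have tail1 i : drop_digits n (greedy x) i.
  by apply: contrapT => /negP bi; apply: h; exists (n + i)%N; rewrite ?leq_addr.
have := value_ones; have -> : ones = drop_digits n (greedy x).
  by apply/funext => i; rewrite tail1.
have := iter_doubling_itv n hx => hn.
by rewrite drop_greedy value_greedy //; lra.
Qed.

(** * Expansions of elements of the deficient digit set *)

Lemma deficient_digit_setP x : deficient_digit_set R x <->
  exists2 b, value b = x & never_negative b.
Proof.
split=> [[_ [b [vb /never_negativeP nb]]]|[b <- nb]]; first by exists b.
split; first by rewrite value_ge0 value_le1.
by exists b; split=> //; apply/never_negativeP.
Qed.

(** A digit sum of index [j] is at most [j / 2], which is the digit sum of
    [(01)^oo]. *)
Lemma never_negative_le b : never_negative b -> value b <= 1 / 3.
Proof.
move=> nb; rewrite -value_zero_ones; apply: le_value => j.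
have -> : digit_sum zero_ones j = j./2.
  elim: j => [|j IH]; rewrite ?digit_sum0 // digit_sumS IH /zero_ones.
  by lia.
by have := nb j; rewrite /deficient; lia.
Qed.

End Value.

(** * Leftmost endpoints of local level sets *)

(** Reflecting the walk [deficient b] at [0] flips exactly the blocks on which
    it is negative. *)
Definition reflection (b : expansion) : expansion :=
  fun i => (absz (deficient b i.+1) < absz (deficient b i))%N.

Lemma deficient_reflection b j : deficient (reflection b) j = `|deficient b j|.
Proof.
elim: j => [|j IH]; first by rewrite !deficient0.
rewrite deficientS IH /reflection !deficientS.
by case: (b j); case: ltnP; lia.
Qed.

Lemma reflection_never_negative b : never_negative (reflection b).
Proof. by move=> j; rewrite deficient_reflection. Qed.

Lemma balance_set_reflection b : balance_set (reflection b) = balance_set b.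
Proof.
by apply/seteqP; split=> j; rewrite /balance_set /= deficient_reflection; lia.
Qed.

Lemma eq_block b b' : balance_set b' = balance_set b -> block b' = block b.
Proof. by move=> eqZ; rewrite /block eqZ. Qed.

(** The walk moves by unit steps, so it cannot change sign inside a block. *)
Lemma block_sign b c i : balance_set b c -> block b c i ->
  if b c then deficient b i <= 0 /\ deficient b i.+1 <= 0
  else 0 <= deficient b i /\ 0 <= deficient b i.+1.
Proof.
move=> Dc [ci]; rewrite -(subnKC ci); elim: (i - c)%N => [_|k IH blk].
  by rewrite addn0 deficientS Dc; case: (b c).
have /IH IHk j : (c < j)%N -> (j <= c + k)%N -> ~ balance_set b j.
  by move=> cj jck; apply: blk => //; lia.
have {blk} : deficient b (c + k).+1 <> 0 by apply: blk; lia.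
move: IHk; rewrite addnS [deficient b (c + k).+2]deficientS.
by case: (b c); case: (b (c + k).+1); lia.
Qed.

Lemma reflection_equivalent b : locally_equivalent (reflection b) b.
Proof.
split=> [|c]; first exact: balance_set_reflection.
rewrite (eq_block (balance_set_reflection b)) balance_set_reflection => Zc.
case bc : (b c); [right|left] => i /(block_sign Zc); rewrite bc /reflection;
  by rewrite deficientS; case: (b i); case: ltnP; lia.
Qed.

Lemma last_balance b j : exists2 c, balance_set b c &
  (c <= j)%N /\ forall k, (c < k)%N -> (k <= j)%N -> ~ balance_set b k.
Proof.
elim: j => [|j [c Zc [cj Zn]]].
  exists 0%N; first exact: deficient0.
  by split=> // k; lia.
have [Zj|Zj] := pselect (balance_set b j.+1).
  by exists j.+1 => //; split=> // k; lia.
exists c => //; split=> [|k ck]; first lia.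
by rewrite leq_eqVlt => /orP[/eqP -> //|kj]; apply: Zn.
Qed.

(** A block is flipped as a whole, and both walks start it at [0]. *)
Lemma equivalent_deficient b b' j : locally_equivalent b' b ->
  `|deficient b' j| = `|deficient b j|.
Proof.
move=> [eqZ eqB]; have [c Zc [cj Zn]] := last_balance b j.
have Zc' : balance_set b' c by rewrite eqZ.
have blk i : (c <= i)%N -> (i < j)%N -> block b' c i.
  move=> ci ij; rewrite (eq_block eqZ); split=> // k ck ki.
  by apply: Zn => //; lia.
rewrite -(subnKC cj); move: (j - c)%N (subnKC cj) => n cnj.
have in_blk k : (k < n)%N -> block b' c (c + k)%N by move=> kn; apply: blk; lia.
have [same|flip] := eqB _ Zc'.
  suff -> : deficient b' (c + n)%N = deficient b (c + n)%N by [].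
  elim: n in_blk {cnj} => [|n IH] in_blk; first by rewrite addn0 Zc Zc'.
  have blkn := in_blk n (ltnSn n).
  by rewrite addnS !deficientS same // IH // => k kn; apply: in_blk; lia.
suff -> : deficient b' (c + n)%N = - deficient b (c + n)%N by rewrite normrN.
elim: n in_blk {cnj} => [|n IH] in_blk; first by rewrite addn0 Zc Zc' oppr0.
have blkn := in_blk n (ltnSn n).
rewrite addnS !deficientS flip // IH => [|k kn]; last by apply: in_blk; lia.
by case: (b' _) => /=; lia.
Qed.

Lemma leftmost_reflection (R : realType) b :
  leftmost_endpoint (local_level_set b) (value R (reflection b)).
Proof.
split; first by exists (reflection b) => //; exact: reflection_equivalent.
move=> _ [b' eqb <-]; apply: le_value => j.
have := equivalent_deficient j eqb; have := deficient_reflection b j.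
by rewrite /deficient; lia.
Qed.

Lemma never_negative_leftmost (R : realType) b : never_negative b ->
  leftmost_endpoint (local_level_set b) (value R b).
Proof.
move=> nb; have -> : value R b = value R (reflection b).
  by apply/eqP; rewrite eq_le !le_value // => j; have := nb j;
    have := deficient_reflection b j; rewrite /deficient; lia.
exact: leftmost_reflection.
Qed.

Lemma leftmost_endpoint_unique (R : realType) L (x y : R) :
  leftmost_endpoint L x -> leftmost_endpoint L y -> x = y.
Proof.
by move=> [Lx lx] [Ly ly]; apply/eqP; rewrite eq_le lx // ly.
Qed.

Lemma deficient_digit_set_leftmost (R : realType) :
  deficient_digit_set R =
  [set x | exists b, leftmost_endpoint (local_level_set b) x].
Proof.
apply/seteqP; split=> x.
  move=> /deficient_digit_setP[b <- nb]; exists b.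
  exact: never_negative_leftmost.
move=> [b /leftmost_endpoint_unique]; move=> /(_ _ (leftmost_reflection R b)) ->.
apply/deficient_digit_setP; exists (reflection b) => //.
exact: reflection_never_negative.
Qed.

(** * Omitted intervals *)

(** The empty word is the word of the breakpoint [0]. Including it makes the
    interval of every breakpoint word [w] run from [w (01)^oo] to [w 1^oo]. *)
Definition breakpoint_word (w : seq bool) : Prop :=
  w = [::] \/ small_breakpoint_word w.

Lemma breakpoint_word_deficient w t : breakpoint_word w ->
  (forall j, (j <= size w)%N -> 0 <= deficient (word_then w t) j) /\
  deficient (word_then w t) (size w) = 0.
Proof.
case=> [->|[m [m1 sw D Dm _]]].
  by split=> [[|j]|] //; rewrite deficient0.
have eqD j : (j <= size w)%N ->
    deficient (word_then w t) j = deficient (word_then w zeros) j.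
  move=> js; apply: eq_deficient => i ij.
  by rewrite /word_then (leq_trans ij js).
split=> [[|j] js|]; first by rewrite deficient0.
  rewrite eqD //; have [jm|jm] := leqP j.+1 (2 * m - 1); first exact: D.
  by have -> : j.+1 = (2 * m)%N; [lia|rewrite Dm].
by rewrite eqD // sw.
Qed.

Lemma breakpoint_word_last w : breakpoint_word w ->
  w = [::] \/ nth false w (size w).-1.
Proof.
case=> [|[m [m1 -> _ _ [_]]]]; first by left.
by rewrite subn1; right.
Qed.

Lemma last_false w : false \in w -> exists l k, w = l ++ false :: nseq k true.
Proof.
elim/last_ind: w => // w a IH; case: a; last first.
  by move=> _; exists w, 0%N; rewrite cats1.
rewrite mem_rcons inE /= => /IH[l [k ->]]; exists l, k.+1.
by rewrite -addn1 nseqD -cats1 -catA cat_cons.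
Qed.

Lemma small_breakpoint_word_split w : small_breakpoint_word w ->
  exists l k, (2 <= k)%N /\ w = l ++ false :: nseq k true.
Proof.
move=> [m [m1 sw D _ [n1 n2]]].
have w0 : nth false w 0 = false.
  have /(D 1%N isT) : (1 <= 2 * m - 1)%N by lia.
  rewrite deficientS deficient0 /word_then sw muln_gt0 m1 /=.
  by case: (nth _ _ _).
have [|l [k ew]] := @last_false w.
  by rewrite -w0 mem_nth // sw; lia.
exists l, k; split=> //; move: sw n1 n2; rewrite ew size_cat /= size_nseq => sw.
case: k {ew} sw => [|[|k]] // sw.
  have -> : (2 * m - 1)%N = size l by lia.
  by rewrite [nth _ _ (size l)]nth_cat ltnn subnn.
have -> : (2 * m - 2)%N = size l by lia.
by rewrite nth_cat ltnn subnn.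
Qed.

Section Gaps.
Variable R : realType.

Notation value := (value R).

(** A breakpoint determines its word, because the word ends with a digit [1]; so
    each breakpoint has a single omitted interval. *)
Lemma word_then_zeros_inj w w' : breakpoint_word w -> breakpoint_word w' ->
  value (word_then w zeros) = value (word_then w' zeros) -> w = w'.
Proof.
move=> /breakpoint_word_last bw /breakpoint_word_last bw' /standard_value_inj eqw.
have {}eqw : word_then w zeros = word_then w' zeros.
  by apply: eqw; apply: standard_word_then; exact: standard_zeros.
have short u v : u = [::] \/ nth false u (size u).-1 ->
    word_then u zeros = word_then v zeros -> (size u <= size v)%N.
  case=> [->//|lu] euv; rewrite leqNgt; apply/negP => vu.
  have us : ((size u).-1 < size u)%N by lia.
  have vs : ((size u).-1 < size v)%N = false by lia.
  by have := congr1 (@^~ (size u).-1) euv; rewrite /word_then us vs lu.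
have sw : size w = size w'.
  by apply/eqP; rewrite eqn_leq !short.
apply: (@eq_from_nth _ false) => // i iw.
by have := congr1 (@^~ i) eqw; rewrite /word_then -sw iw.
Qed.

Lemma value_word_then_ones w :
  value (word_then w ones) = value (word_then w zeros) + 1 / 2 ^+ size w.
Proof. by rewrite value_word_then value_ones. Qed.

Lemma lt_value_word_then w s t :
  (value (word_then w s) < value (word_then w t)) = (value s < value t).
Proof.
rewrite value_word_then [X in _ < X]value_word_then ltrD2l.
by rewrite ltr_pM2r // invr_gt0 exprn_gt0.
Qed.

(** This brings [x(B)^+] to the form [w 1^oo], with the same word [w] as [B] and
    [x(B)^-]. *)
Lemma value_carry l k :
  value (word_then (l ++ true :: nseq k false) zeros) =
  value (word_then (l ++ false :: nseq k true) ones).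
Proof.
have zk : word_then (nseq k false) zeros = zeros.
  by apply/funext => i; rewrite /word_then size_nseq nth_nseq; case: (i < k)%N.
have ok : word_then (nseq k true) ones = ones.
  by apply/funext => i; rewrite /word_then size_nseq nth_nseq; case: (i < k)%N.
rewrite !word_then_cat value_word_then [RHS]value_word_then; congr (_ + _ * _).
rewrite value_rec [RHS]value_rec !drop1_word_then_cons zk ok.
by rewrite value_zeros value_ones /=; lra.
Qed.

Lemma small_breakpointsE (B : R) : small_breakpoints R B <->
  exists2 w, breakpoint_word w & B = value (word_then w zeros).
Proof.
split=> [[->|[w [bw ->]]]|[w [->|bw] ->]].
- by exists [::]; [left|rewrite word_then_nil value_zeros].
- by exists w => //; right.
- by left; rewrite word_then_nil value_zeros.
- by right; exists w.
Qed.

Lemma omitted_endpointsE (B lo hi : R) : omitted_endpoints B lo hi <->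
  exists2 w, breakpoint_word w &
    [/\ B = value (word_then w zeros), lo = value (word_then w zero_ones) &
        hi = value (word_then w ones)].
Proof.
split=> [[[-> -> ->]|[l [k [k2 bw -> -> ->]]]]|[w [->|bw] [-> -> ->]]].
- exists [::]; first by left.
  by rewrite !word_then_nil value_zeros value_zero_ones value_ones.
- by exists (l ++ false :: nseq k true); [right|rewrite value_carry].
- by left; rewrite !word_then_nil value_zeros value_zero_ones value_ones.
- right; have [l [k [k2 ew]]] := small_breakpoint_word_split bw.
  by exists l, k; rewrite -ew value_carry -ew.
Qed.

Lemma omitted_interval_word w : breakpoint_word w ->
  omitted_interval (value (word_then w zeros)) =
  [set x | value (word_then w zero_ones) < x < value (word_then w ones)].
Proof.
move=> bw; apply/seteqP; split=> x /=.
  move=> [lo [hi [/omitted_endpointsE[w' bw' [eqB -> ->]] hx]]].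
  by rewrite (word_then_zeros_inj bw bw' eqB).
move=> hx; exists (value (word_then w zero_ones)), (value (word_then w ones)).
by split=> //; apply/omitted_endpointsE; exists w.
Qed.

(** After [w] a nonnegative walk is at height [0], so its tail is again a
    nonnegative walk, of value at most [1/3]. *)
Lemma omitted_interval_disjoint w b : breakpoint_word w -> never_negative b ->
  ~ (value (word_then w zero_ones) < value b < value (word_then w ones)).
Proof.
move=> bw nb /andP[lob bhi].
have eb : b = word_then w (drop_digits (size w) b).
  apply: (standard_prefix (R := R)); first exact: never_negative_standard.
  rewrite -value_word_then_ones bhi andbT; apply/ltW/(le_lt_trans _ lob).
  by rewrite [leRHS]value_word_then lerDl divr_ge0 ?value_ge0 ?exprn_ge0.
have nd : never_negative (drop_digits (size w) b).
  move=> j; have := nb (size w + j)%N; rewrite deficientD.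
  have [_] := breakpoint_word_deficient (drop_digits (size w) b) bw.
  by rewrite -eb => ->; rewrite add0r.
move: lob; rewrite eb lt_value_word_then value_zero_ones ltNge.
by rewrite (never_negative_le R nd).
Qed.

(** The step to the first negative height is a digit [1] read at height [0], so
    the tail from there is at least [1/2]. Take the least balance point whose
    tail exceeds [1/3]: the word before it cannot end with [01], since the tail
    before these two digits would also exceed [1/3]; it is thus a breakpoint
    word. *)
Lemma omitted_interval_cover b : standard b -> ~ never_negative b ->
  exists2 w, breakpoint_word w &
    value (word_then w zero_ones) < value b < value (word_then w ones).
Proof.
move=> pb nnb.
have [|j jneg jmin] := @ex_minnP (fun j => deficient b j < 0).
  apply: contrapT => h; apply: nnb => j; rewrite leNgt.
  by apply/negP => jneg; apply: h; exists j.
case: j => [|j] in jneg jmin *; first by move: jneg; rewrite deficient0.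
have Dnn i : (i <= j)%N -> 0 <= deficient b i.
  by move=> ij; rewrite leNgt; apply/negP => /jmin; lia.
pose P n := (deficient b n == 0) && (1 / 3 < value (drop_digits n b)).
have [|n /andP[/eqP Dn tail] nmin] := @ex_minnP P.
  exists j; move: jneg (Dnn _ (leqnn j)); rewrite deficientS /P.
  case bj : (b j) => h1 h2; last lia.
  apply/andP; split; first by apply/eqP; lia.
  rewrite value_rec /drop_digits addn0 bj -/(drop_digits 1 _) /=.
  by have := value_ge0 R (drop_digits 1 (drop_digits j b)); lra.
have nj : (n <= j)%N.
  apply: nmin; move: jneg (Dnn _ (leqnn j)); rewrite deficientS /P.
  case bj : (b j) => h1 h2; last lia.
  apply/andP; split; first by apply/eqP; lia.
  rewrite value_rec {1}/drop_digits addn0 bj /=.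
  by have := value_ge0 R (drop_digits 1 (drop_digits j b)); lra.
have small : breakpoint_word (mkseq b n).
  case: n => [|[|n]] in Dn tail nmin nj *; first by left.
    by have := deficient_even Dn.
  have [D0 D1] := (Dnn n (ltnW (ltnW nj)), Dnn n.+1 (ltnW nj)).
  have := Dn; rewrite deficientS => Dn1; have := D1; rewrite deficientS => Dn0.
  have b1 : b n.+1 by move: Dn1; case: (b n.+1) => //; lia.
  have D1' : deficient b n.+1 = 1 by move: Dn1; rewrite b1; lia.
  have b0 : b n.
    apply: contrapT => /negP/negbTE b0.
    (* the tail after n is 01 followed by a tail above 1/3 *)
    have : (n.+2 <= n)%N.
      apply: nmin; apply/andP; split.
        by apply/eqP; move: D1'; rewrite deficientS b0; lia.
      rewrite value_rec [value (drop_digits 1 _)]value_rec !drop_digitsD.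
      rewrite addn1 /= {1 2}/drop_digits addn0 addn0 b0 b1 addn1 /=.
      by move: tail; lra.
    by lia.
  right; exists n./2.+1.
  have n2 : n.+2 = (2 * n./2.+1)%N by have := deficient_even Dn; lia.
  have eqD j' : (j' <= n.+2)%N ->
      deficient (word_then (mkseq b n.+2) zeros) j' = deficient b j'.
    move=> jn; apply: eq_deficient => i ij.
    by rewrite /word_then size_mkseq (leq_trans ij jn) nth_mkseq // (leq_trans ij jn).
  split; first lia.
  - by rewrite size_mkseq.
  - by move=> j' _ j'n; rewrite eqD ?Dnn //; lia.
  - by rewrite -n2 eqD.
  - by rewrite -n2 !nth_mkseq; try lia; rewrite subn1 subn2 /= b1 b0.
exists (mkseq b n) => //.
rewrite -{2 3}(word_then_take n b) !lt_value_word_then value_zero_ones tail /=.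
by rewrite value_ones; apply: standard_value_lt1; exact: standard_drop.
Qed.

Lemma deficient_digit_set_omitted :
  deficient_digit_set R =
  [set x | 0 <= x < 1] `\` \bigcup_(B in small_breakpoints R) omitted_interval B.
Proof.
apply/seteqP; split=> x.
  move=> /deficient_digit_setP[b <- nb]; split.
    by rewrite /= value_ge0 standard_value_lt1 //; exact: never_negative_standard.
  move=> [B /small_breakpointsE[w bw ->]]; rewrite omitted_interval_word //.
  exact: omitted_interval_disjoint.
move=> [/= hx nox]; apply/deficient_digit_setP.
exists (greedy x); first exact: value_greedy.
apply: contrapT => /(omitted_interval_cover (standard_greedy hx))[w bw].
rewrite value_greedy // => xw; apply: nox.
exists (value (word_then w zeros)); first by apply/small_breakpointsE; exists w.
by rewrite omitted_interval_word.
Qed.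

(** As the set lies below [1/3], the half-open interval from [0] to [1] can be
    replaced by a closed one, from which open intervals are removed. *)
Lemma closed_deficient_digit_set : closed (deficient_digit_set R).
Proof.
have -> : deficient_digit_set R = [set` `[0, 1 / 3]] `\`
    \bigcup_(B in small_breakpoints R) omitted_interval B.
  apply/seteqP; split=> x.
    move=> xD; have := xD; rewrite {1}deficient_digit_set_omitted => -[_ nox].
    split=> //; move: xD => /deficient_digit_setP[b <- nb].
    by rewrite /= in_itv /= value_ge0 never_negative_le.
  rewrite deficient_digit_set_omitted => -[+ nox]; rewrite /= in_itv /= => hx.
  by split=> //=; lra.
rewrite setDE; apply: closedI; first exact: interval_closed.
apply: open_closedC; apply: bigcup_open => B /small_breakpointsE[w bw ->].
rewrite omitted_interval_word //.
have -> : [set x | value (word_then w zero_ones) < x < value (word_then w ones)] =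
    [set` `]value (word_then w zero_ones), value (word_then w ones)[].
  by apply/seteqP; split=> x; rewrite /= in_itv.
exact: interval_open.
Qed.

(** * Endpoints of omitted intervals *)

(** Powers of [2] may cancel, the factor [3] cannot. *)
Lemma has_denominator_fraction (M n : nat) : coprime M 3 ->
  exists k, has_denominator (3 * 2 ^ k) (M%:R / (3 * 2 ^+ n) : R).
Proof.
elim: n M => [|n IH] M M3.
  exists 0%N; exists (M%:Z%:~R / 3%:Z%:~R).
  rewrite expr0 mulr1 fmorph_div [in RHS]/= !ratr_int; split=> //.
  by rewrite coprimeq_den.
have [oddM|evenM] := boolP (odd M).
  exists n.+1; exists (M%:Z%:~R / (3 * 2 ^ n.+1)%N%:Z%:~R).
  rewrite fmorph_div [in RHS]/= !ratr_int; split.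
    by rewrite -!pmulrn natrM natrX.
  rewrite coprimeq_den /=; last first.
    by rewrite coprimeMr M3 coprimeXr // coprimen2.
  by rewrite ifF //; apply/negbTE; rewrite eqz_nat muln_eq0 expn_eq0.
have eM : M = (2 * M./2)%N by lia.
have [|k hk] := IH M./2.
  by have := M3; rewrite [X in coprime X _]eM coprimeMl => /andP[].
exists k; move: hk; congr has_denominator.
by rewrite [X in _ = X%:R / _]eM natrM exprS; field; rewrite expf_neq0.
Qed.

Lemma omitted_endpoints_exist (B : R) : small_breakpoints R B ->
  exists lo hi : R,
    [/\ omitted_endpoints B lo hi, lo < hi,
        omitted_interval B = [set x | lo < x < hi],
        dyadic_rational hi &
        exists k : nat, has_denominator (3 * 2 ^ k) lo].
Proof.
move=> /small_breakpointsE[w bw ->].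
exists (value (word_then w zero_ones)), (value (word_then w ones)).
have [N eN] := value_word_nat R w.
split.
- by apply/omitted_endpointsE; exists w.
- by rewrite lt_value_word_then value_zero_ones value_ones; lra.
- exact: omitted_interval_word.
- exists N.+1%:Z, (size w).
  by rewrite value_word_then_ones eN -mulrDl natr1 -pmulrn.
- have [|k hk] := @has_denominator_fraction (3 * N).+1 (size w).
    by rewrite -[(3 * N).+1]addn1 /coprime gcdnC mulnC gcdnMDl.
  exists k; move: hk; congr has_denominator.
  rewrite value_word_then eN value_zero_ones -[(3 * N).+1%:R]natr1 natrM.
  by field; rewrite expf_neq0.
Qed.

End Gaps.

(** * No isolated points *)

Definition flip_digit (n : nat) (b : expansion) : expansion :=
  fun i => if i == n then ~~ b i else b i.

Lemma deficient_flip n b j : deficient (flip_digit n b) j =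
  deficient b j + (if (n < j)%N then if b n then 2 else -2 else 0).
Proof.
elim: j => [|j IH]; first by rewrite !deficient0.
rewrite !deficientS IH /flip_digit ltnS.
have [->|jn] := eqVneq j n; first by rewrite ltnn leqnn; case: (b n) => /=; lia.
by rewrite [(n <= j)%N]leq_eqVlt eq_sym (negbTE jn) /=; lia.
Qed.

(** Flipping a digit [1] raises the walk from then on; flipping a digit [0]
    lowers it by [2], which is harmless far out if all further digits are
    [0]. *)
Lemma never_negative_flip b N : never_negative b ->
  exists2 n, (N <= n)%N & never_negative (flip_digit n b).
Proof.
move=> nb; have [[n Nn bn]|nob] := pselect (exists2 n, (N <= n)%N & b n).
  by exists n => // j; rewrite deficient_flip bn; have := nb j; case: ifP; lia.
have zeroN i : b (N + i)%N = false.
  apply/negbTE/negP => bi; apply: nob.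
  by exists (N + i)%N; rewrite ?leq_addr.
have bN1 : b N.+1 = false by rewrite -addn1 zeroN.
(* from N on the walk only rises, so it is at least 2 after N + 1 *)
exists N.+1 => // j; rewrite deficient_flip bN1.
case: ltnP => Nj; last by rewrite addr0.
have -> : j = (N + (j - N.+2).+2)%N by lia.
rewrite deficientD; have := nb N; suff -> : forall k,
    deficient (drop_digits N b) k = k%:Z by lia.
elim=> [|k IH]; first exact: deficient0.
by rewrite deficientS IH /drop_digits zeroN; lia.
Qed.

Section Topology.
Variable R : realType.

Lemma dist_value_flip n b :
  `|value R (flip_digit n b) - value R b| = 1 / 2 ^+ n.+1.
Proof.
elim: n b => [|n IH] b.
  rewrite value_rec [value R b]value_rec.
  have -> : drop_digits 1 (flip_digit 0 b) = drop_digits 1 b.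
    by apply/funext => i.
  rewrite opprD addrACA subrr addr0 /flip_digit /= expr1.
  by case: (b 0%N) => /=; rewrite ?mul0r ?subr0 ?sub0r ?normrN ger0_norm //; lra.
rewrite value_rec [value R b]value_rec.
have -> : drop_digits 1 (flip_digit n.+1 b) = flip_digit n (drop_digits 1 b).
  by apply/funext => i; rewrite /drop_digits /flip_digit add1n eqSS.
rewrite [flip_digit _ _ 0%N]/flip_digit /= opprD addrACA subrr add0r.
rewrite -mulrBl normrM IH [2 ^+ n.+2]exprS [`|2^-1|]ger0_norm ?invr_ge0 //.
by field; rewrite expf_neq0.
Qed.

Lemma perfect_deficient_digit_set : perfect_set (deficient_digit_set R).
Proof.
split; first exact: closed_deficient_digit_set.
apply/seteqP; split=> [x /subset_limit_point|x].
  by rewrite -(closure_id _).1 //; exact: closed_deficient_digit_set.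
move=> /deficient_digit_setP[b <- nb] U /nbhs_ballP[e /= e0 eU].
have [N he] := ltr_add_invr e0.
have [n Nn nf] := never_negative_flip N nb.
exists (value R (flip_digit n b)); split.
- rewrite -subr_eq0 -normr_gt0 dist_value_flip divr_gt0 // exprn_gt0 //.
- by apply/deficient_digit_setP; exists (flip_digit n b).
apply: eU; rewrite /ball /= distrC dist_value_flip; rewrite add0r in he.
apply: le_lt_trans he; rewrite mul1r lef_pV2 ?posrE ?exprn_gt0 //.
rewrite -natrX ler_nat (leq_trans _ (ltnW (ltn_expl n.+1 _))) //.
Qed.

(** * Lebesgue measure *)

(** The words of length [n] that keep a walk started at height [k] positive, each
    given by its value, the left endpoint of its dyadic interval. The barrier is
    at [0], so the walks of the deficient digit set start at height [1]. *)
Fixpoint left_endpoints (n k : nat) : seq R :=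
  match n, k with
  | _, 0 => [::]
  | 0, k.+1 => [:: 0]
  | n.+1, k.+1 => map (fun a => a / 2) (left_endpoints n k.+2) ++
                  map (fun a => 1 / 2 + a / 2) (left_endpoints n k)
  end.

Lemma left_endpoints_cover n k b :
  (forall j, 0 < k%:Z + deficient b j) ->
  exists2 a, a \in left_endpoints n k & a <= value R b <= a + 1 / 2 ^+ n.
Proof.
elim: n k b => [|n IH] [|k] b pos; try by have := pos 0%N; rewrite deficient0.
  exists 0; first by rewrite inE.
  by rewrite value_ge0 expr0 divr1 add0r value_le1.
have step j := pos j.+1; have eb j : deficient b j.+1 =
    (if b 0%N then -1 else 1) + deficient (drop_digits 1 b) j.
  by rewrite -add1n deficientD deficientS deficient0 add0r.
rewrite value_rec exprS invfM; case b0 : (b 0%N) => /=.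
  have [|a ain ha] := IH k (drop_digits 1 b).
    by move=> j; have := step j; rewrite eb b0; lia.
  exists (1 / 2 + a / 2); last by lra.
  by rewrite mem_cat (map_f (fun a => 1 / 2 + a / 2) ain) orbT.
have [|a ain ha] := IH k.+2 (drop_digits 1 b).
  by move=> j; have := step j; rewrite eb b0; lia.
exists (a / 2); last by lra.
by rewrite mem_cat (map_f (fun a => a / 2) ain).
Qed.

(** The probability that a fair walk started at height [k] stays positive for [n]
    steps; also the total length of the covering dyadic intervals. *)
Definition survival (n k : nat) : R := (size (left_endpoints n k))%:R / 2 ^+ n.

Lemma survival_n0 n : survival n 0 = 0.
Proof. by rewrite /survival; case: n => [|n]; rewrite mul0r. Qed.

Lemma survival_0S k : survival 0 k.+1 = 1.
Proof. by rewrite /survival expr0 divr1. Qed.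

Lemma survival_SS n k :
  survival n.+1 k.+1 = (survival n k.+2 + survival n k) / 2.
Proof.
rewrite /survival /= size_cat !size_map natrD exprS.
by field; rewrite expf_neq0.
Qed.

Lemma survival_ge0 n k : 0 <= survival n k.
Proof. by rewrite divr_ge0 // exprn_ge0. Qed.

Lemma survival_le1 n k : survival n k <= 1.
Proof.
elim: n k => [|n IH] [|k]; rewrite ?survival_n0 ?survival_0S //.
by rewrite survival_SS; have := IH k; have := IH k.+2; lra.
Qed.

Lemma survival_nonincreasing k : nonincreasing_seq (survival ^~ k).
Proof.
apply/nonincreasing_seqP => n; elim: n k => [|n IH] [|k]; rewrite ?survival_n0 //.
  by rewrite survival_0S survival_le1.
rewrite survival_SS [leRHS]survival_SS; have := IH k; have := IH k.+2.
by rewrite ler_pM2r //; lra.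
Qed.

(** The limit of the survival probabilities is harmonic in the height and
    vanishes at [0], hence linear; being bounded, it is [0]. *)
Lemma survival_cvg0 : survival ^~ 1 @ \oo --> (0 : R).
Proof.
have cvg_s k : cvgn (survival ^~ k).
  apply: nonincreasing_is_cvgn; first exact: survival_nonincreasing.
  by exists 0 => _ [n _ <-]; exact: survival_ge0.
pose p k := limn (survival ^~ k).
have p0 : p 0%N = 0.
  by apply: lim_near_cst => //; apply: nearW => n; exact: survival_n0.
have harmonic k : p k.+1 = (p k.+2 + p k) / 2.
  apply: cvg_lim => //; rewrite -cvg_shiftS.
  under eq_fun do rewrite survival_SS.
  by apply: cvgMl; apply: cvgD; exact: cvg_s.
have linear k : p k = k%:R * p 1%N /\ p k.+1 = k.+1%:R * p 1%N.
  elim: k => [|k [IH1 IH2]]; first by rewrite p0 mul0r mul1r.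
  split=> //; have := harmonic k; rewrite IH1 IH2.
  rewrite -[k.+2%:R]natr1 -[k.+1%:R]natr1.
  by move: (k%:R : R) (p 1%N) (p k.+2) => x y z; lra.
have p_ge0 : 0 <= p 1%N.
  by apply: limr_ge => //; apply: nearW => n; exact: survival_ge0.
have p_le1 k : p k <= 1.
  by apply: limr_le => //; apply: nearW => n; exact: survival_le1.
suff <- : p 1%N = 0 by exact: cvg_s.
apply/eqP; rewrite eq_le p_ge0 andbT leNgt; apply/negP => p_gt0.
have [n] := ltr_add_invr p_gt0; rewrite add0r => np.
have := p_le1 n.+1; rewrite (linear n.+1).1 leNgt.
by rewrite mulrC -ltr_pdivrMr // div1r np.
Qed.

Lemma lebesgue_measure_cover (A : set R) (s : seq R) (r : R) :
  0 <= r -> measurable A ->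
  A `<=` [set x | exists2 a, a \in s & a <= x <= a + r] ->
  (lebesgue_measure A <= ((size s)%:R * r)%:E)%E.
Proof.
move=> r0; elim: s A => [|a s IH] A mA Acov.
  have -> : A = set0 by rewrite -subset0 => x /Acov[].
  by rewrite measure0 mul0r.
have mI : measurable (`[a, a + r] : set R) by exact: measurable_itv.
have -> : A = (A `&` `[a, a + r]) `|` (A `\` `[a, a + r]) by rewrite setUIDK.
apply: (le_trans (measureU2 _ _ _)).
- exact: measurableI.
- exact: measurableD.
rewrite /= -natr1 mulrDl mul1r [_ * r + r]addrC EFinD; apply: leeD.
  apply: (@le_trans _ _ (lebesgue_measure (`[a, a + r] : set R))).
    by apply: le_measure; rewrite ?inE //; exact: measurableI.
  rewrite lebesgue_measure_itv /=; case: ifP => _; last by rewrite lee_fin.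
  by rewrite -EFinD lee_fin; lra.
apply: IH; first exact: measurableD.
move=> x [/Acov[c]]; rewrite inE => /predU1P[->|cs] hc /=.
  by rewrite in_itv /= hc.
by exists c.
Qed.

Lemma lebesgue_measure_deficient_digit_set :
  lebesgue_measure (deficient_digit_set R) = 0%E.
Proof.
apply/eqP; rewrite eq_le measure_ge0 andbT.
have bound n : (lebesgue_measure (deficient_digit_set R) <= (survival n 1)%:E)%E.
  rewrite /survival -[X in _ / X]invrK invrK -div1r.
  apply: lebesgue_measure_cover.
  - by rewrite divr_ge0 // exprn_ge0.
  - by apply: closed_measurable; exact: closed_deficient_digit_set.
  move=> x /deficient_digit_setP[b <- nb].
  by apply: left_endpoints_cover => j; have := nb j; lia.
apply/lee_addgt0Pr => e e0; rewrite add0e.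
have /cvgrPdist_lt/(_ e e0)[n _ /(_ n (leqnn n))] := survival_cvg0.
rewrite /= sub0r normrN ger0_norm ?survival_ge0 // => sn.
by apply: (le_trans (bound n)); rewrite lee_fin ltW.
Qed.

(** Connected components in the line are intervals, and a nondegenerate interval
    has positive measure. *)
Lemma totally_disconnected_null (A : set R) : measurable A ->
  lebesgue_measure A = 0%E -> totally_disconnected A.
Proof.
move=> mA A0 x Ax; apply/seteqP; split; last first.
  by move=> _ ->; exact: connected_component_refl.
have /connected_intervalP itvC : connected (connected_component A x).
  exact: component_connected.
have no_itv u v : connected_component A x u -> connected_component A x v -> ~ u < v.
  move=> Cu Cv uv.
  have : (lebesgue_measure (`[u, v] : set R) <= lebesgue_measure A)%E.
    apply: le_measure; rewrite ?inE //.
    move=> z /=; rewrite in_itv /= => uzv.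
    by apply: (@connected_component_sub _ _ x); exact: itvC uzv.
  by rewrite A0 lebesgue_measure_itv /= lte_fin uv -EFinD lee_fin; lra.
have Cx : connected_component A x x by exact: connected_component_refl.
move=> y Cy /=; apply/eqP; rewrite eq_le !leNgt; apply/andP.
by split; apply/negP; exact: no_itv.
Qed.

Lemma cantor_deficient_digit_set : cantor_set (deficient_digit_set R).
Proof.
have clD : closed (deficient_digit_set R) by exact: closed_deficient_digit_set.
split.
- exists 0; apply/deficient_digit_setP; exists zeros; first exact: value_zeros.
  by move=> j; rewrite /deficient /digit_sum big1.
- apply: (subclosed_compact clD (@segment_compact R 0 1)) => x [hx _].
  by rewrite /= in_itv.
- exact: perfect_deficient_digit_set.
- apply: totally_disconnected_null; first exact: closed_measurable.
  exact: lebesgue_measure_deficient_digit_set.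
Qed.

End Topology.

Theorem theorem4p6 (R : realType) :
  [/\ (* (1) *)
      [/\ forall b : expansion,
            exists x : R, leftmost_endpoint (local_level_set b) x,
          deficient_digit_set R =
            [set x | exists b : expansion,
               leftmost_endpoint (local_level_set b) x] &
          deficient_digit_set R `<=` [set x | 0 <= x <= 1 / 3]],
      (* (2) *)
      [/\ closed (deficient_digit_set R),
          perfect_set (deficient_digit_set R),
          cantor_set (deficient_digit_set R),
          deficient_digit_set R =
            [set x | 0 <= x < 1]
            `\` \bigcup_(B in small_breakpoints R) omitted_interval B &
          forall B : R, small_breakpoints R B ->
            exists lo hi : R,
              [/\ omitted_endpoints B lo hi,
                  lo < hi,
                  omitted_interval B = [set x | lo < x < hi],
                  dyadic_rational hi &
                  exists k : nat, has_denominator (3 * 2 ^ k) lo]] &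
      (* (3) *)
      lebesgue_measure (deficient_digit_set R) = 0%E].
Proof.
split.
- split; last 1 first.
  + move=> x /deficient_digit_setP[b <- nb] /=.
    by rewrite value_ge0 never_negative_le.
  + by move=> b; exists (value R (reflection b)); exact: leftmost_reflection.
  + exact: deficient_digit_set_leftmost.
- split.
  + exact: closed_deficient_digit_set.
  + exact: perfect_deficient_digit_set.
  + exact: cantor_deficient_digit_set.
  + exact: deficient_digit_set_omitted.
  + exact: omitted_endpoints_exist.
- exact: lebesgue_measure_deficient_digit_set.
Qed.
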